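(* Let $n\in\mathbb{N}$. For any nontrivial, balanced, reduced word $w\in\mathbb{F}_n$ of length $\ell$ and any $\lambda\in\mathbb{T}$, there exists a representation $\pi:C^*(\mathbb{F}_n)\to\mathbb{M}_{2\ell}$ such that $\lambda\in\sigma(\pi(w))$.
   Context: $\mathbb{F}_n$ is the free group on $n$ generators, $C^*(\mathbb{F}_n)$ its full group $C^*$-algebra (with $\mathbb{F}_n$ viewed as unitaries in it), $\mathbb{M}_{d}$ the algebra of complex $d\times d$ matrices, $\mathbb{T}$ the unit circle in $\mathbb{C}$, and $\sigma(\cdot)$ the spectrum of a matrix. A representation $C^*(\mathbb{F}_n)\to\mathbb{M}_d$ is a $*$-homomorphism. A word $w\in\mathbb{F}_n$ is balanced if every nonzero representation (equivalently, unital $*$-homomorphism) $C^*(\mathbb{F}_n)\to\mathbb{C}$ maps $w$ to $1$. *)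

(* Defs.v *)
From HB Require Import structures.
From mathcomp Require Import all_boot all_order all_algebra.
From mathcomp Require Import complex.
From mathcomp Require Import all_classical all_reals.

Set Implicit Arguments.
Unset Strict Implicit.
Unset Printing Implicit Defensive.

Import Order.TTheory GRing.Theory Num.Theory.
Local Open Scope ring_scope.

(* A letter (i, true) is the i-th free generator, (i, false) its inverse.     *)
Section FreeGroup.
Variable n : nat.
Local Notation letter := ('I_n * bool)%type.

Definition letter_inv (a : letter) : letter := (a.1, ~~ a.2).

Definition reduced (s : seq letter) : bool :=
  sorted (fun a b => b != letter_inv a) s.

Record free_group := FreeWord { word : seq letter; _ : reduced word }.

HB.instance Definition _ := [isSub for word].
HB.instance Definition _ := [Choice of free_group by <:].

(* Left multiplication of a reduced word by a letter, with cancellation.      *)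
Definition push (a : letter) (s : seq letter) : seq letter :=
  if s is b :: s' then if b == letter_inv a then s' else a :: s else [:: a].

Lemma letter_invK : involutive letter_inv.
Proof. by case=> i b; rewrite /letter_inv negbK. Qed.

Lemma push_reduced a s : reduced s -> reduced (push a s).
Proof.
case: s => [//|b s] /= rs; case: ifPn => [_|nb]; first exact: path_sorted rs.
by rewrite /= nb.
Qed.

Lemma pushK a s : reduced s -> push a (push (letter_inv a) s) = s.
Proof.
case: s => [|b s] /=; first by rewrite eqxx.
rewrite letter_invK; case: eqP => [->|_]; last by rewrite /= eqxx.
by case: s => [//|c s] /=; case: ifPn => // /eqP ->; rewrite eqxx.
Qed.

Lemma push_cons a s : reduced (a :: s) -> push a s = a :: s.
Proof. by case: s => [//|b s] /= /andP[/negPf ->]. Qed.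

Lemma reduced_behead a s : reduced (a :: s) -> reduced s.
Proof. exact: path_sorted. Qed.

Lemma word_mul_reduced s t : reduced t -> reduced (foldr push t s).
Proof. by move=> rt; elim: s => //= a s; exact: push_reduced. Qed.

Lemma word_inv_reduced s : reduced s -> reduced (rev (map letter_inv s)).
Proof.
rewrite /reduced rev_sorted sorted_map; apply: sub_sorted => a b /=.
by apply: contraNN => /eqP ->; rewrite letter_invK.
Qed.

Lemma word_reduced (x : free_group) : reduced (word x).
Proof. by case: x. Qed.

Definition fg_one : free_group := @FreeWord [::] isT.
Definition fg_mul (x y : free_group) : free_group :=
  FreeWord (word_mul_reduced (word x) (word_reduced y)).
Definition fg_inv (x : free_group) : free_group :=
  FreeWord (word_inv_reduced (word_reduced x)).

Lemma foldr_push a s t : reduced s -> reduced t ->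
  foldr push t (push a s) = push a (foldr push t s).
Proof.
case: s => [//|b s] /= rs rt; case: eqP => [->|//].
by rewrite pushK // word_mul_reduced.
Qed.

Lemma fg_mulA : associative fg_mul.
Proof.
move=> [s rs] [t rt] [v rv]; apply/val_inj => /=.
elim: s rs => [//|a s IHs] ras /=; have rs := reduced_behead ras.
by rewrite foldr_push ?word_mul_reduced // -IHs.
Qed.

Lemma fg_mul1 : left_id fg_one fg_mul.
Proof. by move=> x; apply/val_inj. Qed.

Lemma fg_mulr1 : right_id fg_one fg_mul.
Proof.
move=> [s rs]; apply/val_inj => /=; elim: s rs => [//|a s IHs] ras /=.
by rewrite IHs ?push_cons //; exact: reduced_behead ras.
Qed.

Lemma fg_mulV : left_inverse fg_one fg_inv fg_mul.
Proof.
move=> [s rs]; apply/val_inj => /=; elim: s rs => [//|a s IHs] ras /=.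
have rs := reduced_behead ras; rewrite rev_cons -cats1 foldr_cat /=.
by rewrite letter_invK eqxx IHs.
Qed.

Lemma fg_mulrV : right_inverse fg_one fg_inv fg_mul.
Proof.
have invK x : fg_inv (fg_inv x) = x.
  apply/val_inj => /=; rewrite map_rev revK -map_comp.
  by rewrite (eq_map letter_invK) map_id.
by move=> x; rewrite -{1}[x]invK fg_mulV.
Qed.

HB.instance Definition _ :=
  isGroup.Build free_group fg_mulA fg_mul1 fg_mulr1 fg_mulV fg_mulrV.

End FreeGroup.

Notation word_length w := (size (word w)).

(* Nonzero unital C*-algebras. The hierarchy has no join of rings and normed  *)
(* modules other than number domains, so the norm is a field of the mixin and *)
(* completeness is stated for Cauchy sequences.                               *)
HB.mixin Record isCstarAlgebra (R : realType) A of GRing.Algebra R[i] A := {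
  star : A -> A;
  starD : {morph star : x y / x + y};
  starZ : forall (a : R[i]) (x : A), star (a *: x) = a^* *: star x;
  starM : forall x y : A, star (x * y) = star y * star x;
  starK : involutive star;
  cnorm : A -> R;
  cnorm_eq0 : forall x : A, cnorm x = 0 -> x = 0;
  cnormD : forall x y : A, cnorm (x + y) <= cnorm x + cnorm y;
  cnormZ : forall (a : R[i]) (x : A),
    (cnorm (a *: x))%:C%C = `|a| * (cnorm x)%:C%C;
  cnormM : forall x y : A, cnorm (x * y) <= cnorm x * cnorm y;
  cnorm_star : forall x : A, cnorm (star x * x) = cnorm x ^+ 2;
  cnorm_complete : forall x_ : nat -> A,
    (forall e : R, 0 < e -> exists N : nat, forall m n : nat,
      (N <= m)%N -> (N <= n)%N -> cnorm (x_ m - x_ n) < e) ->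
    exists x : A, forall e : R, 0 < e -> exists N : nat, forall n : nat,
      (N <= n)%N -> cnorm (x_ n - x) < e
}.

#[short(type="cstarAlgType")]
HB.structure Definition CstarAlgebra (R : realType) :=
  { A of GRing.Algebra R[i] A & isCstarAlgebra R A }.

Definition unital_star_hom (R : realType) (A B : cstarAlgType R)
    (f : A -> B) : Prop :=
  [/\ linear f, f 1 = 1, {morph f : x y / x * y}
    & {morph f : x / star x}].

Definition unitary (R : realType) (A : cstarAlgType R) (x : A) : Prop :=
  star x * x = 1 /\ x * star x = 1.

Definition unitary_rep (R : realType) (G : groupType) (A : cstarAlgType R)
    (u : G -> A) : Prop :=
  [/\ u 1%g = 1, forall g h, u (g * h)%g = u g * u h & forall g, unitary (u g)].

(* (A, u) is the full group C*-algebra C*(G) with its canonical inclusion of  *)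
(* G as unitaries: the universal property determines (A, u) up to a unique    *)
(* *-isomorphism.                                                             *)
Definition is_full_group_cstar (R : realType) (G : groupType)
    (A : cstarAlgType R) (u : G -> A) : Prop :=
  unitary_rep u /\
  forall (B : cstarAlgType R) (v : G -> B), unitary_rep v ->
    exists! f : A -> B, unital_star_hom f /\ forall g, f (u g) = v g.

(* Representations, as *-homomorphisms, are not required to be unital.        *)
Definition mx_rep (R : realType) (A : cstarAlgType R) (d : nat)
    (f : A -> 'M[R[i]]_d) : Prop :=
  [/\ linear f, forall x y, f (x * y) = f x *m f y
    & forall x, f (star x) = map_mx Num.conj (f x)^T].

Definition scalar_rep (R : realType) (A : cstarAlgType R)
    (f : A -> R[i]) : Prop :=
  [/\ scalar f, {morph f : x y / x * y} & forall x, f (star x) = (f x)^*].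

Definition balanced (R : realType) (G : groupType) (A : cstarAlgType R)
    (u : G -> A) (w : G) : Prop :=
  forall chi : A -> R[i], scalar_rep chi -> (exists x, chi x != 0) ->
    chi (u w) = 1.

Definition spectrum (R : realType) (d : nat) (x : 'M[R[i]]_d) : set R[i] :=
  [set z | z%:M - x \notin unitmx]%classic.

(* Main.v *)
Require Import Defs.
From HB Require Import structures.
From mathcomp Require Import all_boot all_order all_algebra perm.
From mathcomp Require Import complex.
From mathcomp Require Import all_classical all_reals.
From mathcomp Require Import topology normedtype.

(** Letting the letters of a cyclically reduced word [c] of length [m] label
    the edges of an [m]-cycle turns every generator into a partial injection of
    the [m] vertices: two edges with the same generator can only meet at a
    vertex if two cyclically consecutive letters of [c] are mutually inverse.
    Partial injections of a finite set extend to permutations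
    ([perm_extending]), and putting the phase [lambda] on one single edge turns
    these permutations into monomial unitaries for which [c] carries the first
    basis vector once around the cycle and back to [lambda] times itself.  So
    [lambda] is an eigenvalue of [c] in every dimension at least [m]
    ([cyclic_word_eigenvalue]).  A reduced word that is not cyclically reduced
    is [a t a^-1] with [t] a shorter nontrivial reduced word, and conjugating by
    the unitary of [a] keeps the eigenvalues, so induction on the length covers
    all nontrivial reduced words ([reduced_word_eigenvalue]), in particular in
    dimension [2 * l].

    To pass from unitaries to a representation of the full group C*-algebra,
    its universal property needs a C*-algebra as target.  Hence the square
    complex matrices are equipped with the operator norm of the Euclidean norm;
    the two points that take work are the C*-identity, from Cauchy-Schwarz
    ([opnorm_star]), and completeness, by comparison with the entries
    ([opnorm_complete]). *)

Set Implicit Arguments.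
Unset Strict Implicit.
Unset Printing Implicit Defensive.

Import Order.TTheory GRing.Theory Num.Theory.
Import numFieldNormedType.Exports.
Local Open Scope classical_set_scope.
Local Open Scope ring_scope.

(** * The Euclidean norm of a complex row vector *)

Section VectorNorm.
Local Open Scope complex_scope.
Import Normc.
Context {R : realType} {d : nat}.
Local Notation C := R[i].
Implicit Types (u v : 'rV[C]_d) (a : C).

Definition vnorm v : R := complex.Re (sqrtC (dotmx v v)).

Lemma vnormE v : (vnorm v)%:C = sqrtC (dotmx v v).
Proof. by rewrite /vnorm RRe_real // ger0_real // sqrtC_ge0 dnorm_ge0. Qed.

Lemma vnorm_ge0 v : 0 <= vnorm v.
Proof. by rewrite -lecR vnormE sqrtC_ge0 dnorm_ge0. Qed.

Lemma vnorm_eq0 v : (vnorm v == 0) = (v == 0).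
Proof. by rewrite -(inj_eq (@complexI R)) vnormE sqrtC_eq0 dnorm_eq0. Qed.

Lemma vnorm0 : vnorm 0 = 0.
Proof. by apply/eqP; rewrite vnorm_eq0. Qed.

Lemma vnormD u v : vnorm (u + v) <= vnorm u + vnorm v.
Proof. by rewrite -lecR rmorphD /= !vnormE; exact: triangle_lerif. Qed.

Lemma vnormZ a v : vnorm (a *: v) = normc a * vnorm v.
Proof.
apply: complexI; rewrite rmorphM /= !vnormE dnormZ.
by rewrite sqrtCM ?nnegrE ?exprn_ge0 ?dnorm_ge0 // sqrCK.
Qed.

Lemma vnorm_sum (I : Type) (r : seq I) (F : I -> 'rV[C]_d) :
  vnorm (\sum_(i <- r) F i) <= \sum_(i <- r) vnorm (F i).
Proof.
elim/big_ind2: _ => //; first by rewrite vnorm0.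
by move=> x a y b xa yb; exact: le_trans (vnormD _ _) (lerD xa yb).
Qed.

Lemma vnorm_dot_sqr v : ((vnorm v) ^+ 2)%:C = dotmx v v.
Proof. by rewrite rmorphXn /= vnormE sqrtCK. Qed.

Lemma vnorm_CauchySchwarz u v : normc (dotmx u v) <= vnorm u * vnorm v.
Proof. by rewrite -lecR rmorphM /= !vnormE; exact: CauchySchwarz_sqrt. Qed.

Lemma dotmx_delta v (i : 'I_d) : dotmx v (delta_mx 0 i) = v 0 i.
Proof.
rewrite dotmxE mxE (bigD1 i) //= big1 => [|j ji]; rewrite !mxE !eqxx /=.
  by rewrite conjC1 mulr1 addr0.
by rewrite (negPf ji) conjC0 mulr0.
Qed.

Lemma vnorm_delta (i : 'I_d) : vnorm (delta_mx 0 i : 'rV[C]_d) = 1.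
Proof. by apply: complexI; rewrite vnormE dotmx_delta mxE !eqxx sqrtC1. Qed.

Lemma normc_entry_le v (i : 'I_d) : normc (v 0 i) <= vnorm v.
Proof.
by rewrite -dotmx_delta -[leRHS]mulr1 -(vnorm_delta i) vnorm_CauchySchwarz.
Qed.

Lemma vnorm_le_sum v : vnorm v <= \sum_i normc (v 0 i).
Proof.
rewrite {1}[v]row_sum_delta; apply: le_trans (vnorm_sum _ _) _.
by apply: ler_sum => i _; rewrite vnormZ vnorm_delta mulr1.
Qed.

Lemma normc_ge0 a : 0 <= normc a.
Proof. by rewrite -lecR; exact: (normr_ge0 a). Qed.

End VectorNorm.

(** * The operator norm and the C*-identity *)

Section Adjoint.
Local Open Scope sesquilinear_scope.
Context {C : numClosedFieldType} {m n p : nat}.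

Lemma adjmxM (A : 'M[C]_(m, n)) (B : 'M[C]_(n, p)) :
  (A *m B)^t* = B^t* *m A^t*.
Proof. by rewrite trmx_mul map_mxM. Qed.

Lemma dotmx_adj (u : 'rV[C]_m) (v : 'rV[C]_n) (A : 'M[C]_(m, n)) :
  dotmx (u *m A) v = dotmx u (v *m A^t*).
Proof. by rewrite !dotmxE trmx_mul map_mxM trmxCK mulmxA. Qed.

End Adjoint.

Section OperatorNorm.
Local Open Scope complex_scope.
Local Open Scope sesquilinear_scope.
Import Normc.
Context {R : realType} {d : nat}.
Local Notation C := R[i].
Implicit Types (A B : 'M[C]_d) (u v : 'rV[C]_d) (a : C) (c : R).

(** As an infimum of bounds rather than a supremum over the unit ball, the norm
    is bounded above by exhibiting one bound, and the infimum is itself a bound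
    ([opnorm_le], [vnorm_mulmx]). *)
Definition opnorm A : R :=
  inf [set c | 0 <= c /\ forall v, vnorm (v *m A) <= c * vnorm v].

Lemma vnorm_mulmx_le A v :
  vnorm (v *m A) <= (\sum_i vnorm (row i A)) * vnorm v.
Proof.
rewrite mulmx_sum_row; apply: le_trans (vnorm_sum _ _) _; rewrite mulr_suml.
apply: ler_sum => i _; rewrite vnormZ mulrC.
by rewrite ler_wpM2l ?vnorm_ge0 ?normc_entry_le.
Qed.

(** The infimum is over a nonempty set; the infimum of the empty set would be
    a default value. *)
Lemma opnorm_bound_nonempty A :
  [set c | 0 <= c /\ forall v, vnorm (v *m A) <= c * vnorm v] !=set0.
Proof.
exists (\sum_i vnorm (row i A)); split=> [|v]; last exact: vnorm_mulmx_le.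
by apply: sumr_ge0 => i _; exact: vnorm_ge0.
Qed.

Lemma opnorm_ge0 A : 0 <= opnorm A.
Proof. by apply: lb_le_inf (opnorm_bound_nonempty A) _ => c []. Qed.

Lemma opnorm_le A c :
  0 <= c -> (forall v, vnorm (v *m A) <= c * vnorm v) -> opnorm A <= c.
Proof. by move=> c0 Ac; apply: ge_inf => //; exists 0 => x []. Qed.

Lemma vnorm_mulmx A v : vnorm (v *m A) <= opnorm A * vnorm v.
Proof.
have [->|v0] := eqVneq v 0; first by rewrite mul0mx vnorm0 mulr0.
have vp : 0 < vnorm v by rewrite lt_def vnorm_eq0 v0 vnorm_ge0.
rewrite -ler_pdivrMr //; apply: lb_le_inf (opnorm_bound_nonempty A) _.
by move=> c [c0 Ac]; rewrite ler_pdivrMr.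
Qed.

Lemma normc_entry_le_opnorm A i j : normc (A i j) <= opnorm A.
Proof.
have := vnorm_mulmx A (delta_mx 0 i); rewrite vnorm_delta mulr1 -rowE.
by apply: le_trans; have := normc_entry_le (row i A) j; rewrite mxE.
Qed.

Lemma opnorm_le_sum A : opnorm A <= \sum_i \sum_j normc (A i j).
Proof.
have vle i : vnorm (row i A) <= \sum_j normc (A i j).
  by apply: le_trans (vnorm_le_sum _) _; apply: ler_sum => j _; rewrite mxE.
apply: opnorm_le => [|v].
  by apply: sumr_ge0 => i _; exact: le_trans (vnorm_ge0 _) (vle i).
apply: le_trans (vnorm_mulmx_le A v) _.
by rewrite ler_wpM2r ?vnorm_ge0 // ler_sum.
Qed.

Lemma opnorm_eq0 A : opnorm A = 0 -> A = 0.
Proof.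
move=> A0; apply/matrixP => i j; rewrite mxE; apply: eq0_normc; apply/eqP.
by rewrite eq_le -{1}A0 normc_entry_le_opnorm normc_ge0.
Qed.

Lemma opnormD A B : opnorm (A + B) <= opnorm A + opnorm B.
Proof.
apply: opnorm_le => [|v]; first by rewrite addr_ge0 ?opnorm_ge0.
rewrite mulmxDr mulrDl; apply: le_trans (vnormD _ _) (lerD _ _);
  exact: vnorm_mulmx.
Qed.

Lemma opnormZ a A : opnorm (a *: A) = normc a * opnorm A.
Proof.
have leZ b B : opnorm (b *: B) <= normc b * opnorm B.
  apply: opnorm_le => [|v]; first by rewrite mulr_ge0 ?opnorm_ge0 ?normc_ge0.
  by rewrite -scalemxAr vnormZ -mulrA ler_wpM2l ?normc_ge0 ?vnorm_mulmx.
apply: le_anti; apply/andP; split; first exact: leZ.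
have [->|a0] := eqVneq a 0; first by rewrite normc0 mul0r opnorm_ge0.
have na0 : 0 < normc a.
  by rewrite lt_def normc_ge0 andbT; apply: contra_neq a0 => /eq0_normc.
have := leZ a^-1 (a *: A); rewrite scalerA mulVf // scale1r normcV //.
by rewrite ler_pdivlMl.
Qed.

Lemma opnormM A B : opnorm (A *m B) <= opnorm A * opnorm B.
Proof.
apply: opnorm_le => [|v]; first by rewrite mulr_ge0 ?opnorm_ge0.
rewrite mulmxA; apply: le_trans (vnorm_mulmx _ _) _.
rewrite -mulrA [leRHS]mulrCA; apply: ler_wpM2l (vnorm_mulmx A v).
exact: opnorm_ge0.
Qed.

(** The square of [vnorm (v *m A)] is the inner product of [v *m (A *m A^t* )]
    with [v], to which Cauchy-Schwarz applies. *)
Lemma opnorm_adj_sqr A : opnorm A ^+ 2 <= opnorm (A *m A^t*).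
Proof.
have S0 : 0 <= opnorm (A *m A^t*) by exact: opnorm_ge0.
rewrite -[leRHS]sqr_sqrtr // ler_sqr ?nnegrE ?opnorm_ge0 ?sqrtr_ge0 //.
apply: opnorm_le => [|v]; first exact: sqrtr_ge0.
rewrite -ler_sqr ?nnegrE ?mulr_ge0 ?vnorm_ge0 ?sqrtr_ge0 //.
rewrite exprMn sqr_sqrtr //.
have -> : vnorm (v *m A) ^+ 2 = normc (dotmx (v *m (A *m A^t*)) v).
  apply: complexI; rewrite vnorm_dot_sqr mulmxA [in RHS]dotmx_adj trmxCK.
  by apply/esym/ger0_norm/dnorm_ge0.
apply: le_trans (vnorm_CauchySchwarz _ _) _.
by rewrite expr2 mulrA ler_wpM2r ?vnorm_ge0 // vnorm_mulmx.
Qed.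

Lemma opnorm_adj A : opnorm (A^t*) = opnorm A.
Proof.
suff le B : opnorm B <= opnorm (B^t*).
  apply: le_anti; apply/andP; split; last exact: le.
  by have := le (A^t*); rewrite trmxCK.
have [->|B0] := eqVneq (opnorm B) 0; first exact: opnorm_ge0.
have Bp : 0 < opnorm B by rewrite lt_def B0 opnorm_ge0.
rewrite -(ler_pM2l Bp); apply: le_trans (opnormM _ _).
exact: opnorm_adj_sqr.
Qed.

Lemma opnorm_star A : opnorm (A^t* *m A) = opnorm A ^+ 2.
Proof.
apply/eqP; rewrite eq_le; apply/andP; split.
  by apply: le_trans (opnormM _ _) _; rewrite opnorm_adj.
by have := opnorm_adj_sqr (A^t*); rewrite opnorm_adj trmxCK.
Qed.

End OperatorNorm.

(** * Completeness of the matrix algebra *)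

Section Completeness.
Local Open Scope complex_scope.
Import Normc.
Context {R : realType}.
Local Notation C := R[i].

Lemma real_cauchy_cvg (u : nat -> R) :
  (forall e : R, 0 < e -> exists N : nat, forall m n : nat,
     (N <= m)%N -> (N <= n)%N -> `|u m - u n| < e) ->
  exists l : R, forall e : R, 0 < e -> exists N : nat, forall n : nat,
     (N <= n)%N -> `|u n - l| < e.
Proof.
move=> uC; suff /cvg_ex [l ul] : cvg (u @ \oo).
  exists l => e e0; have [N _ uN] := (cvgrPdist_lt _ _).1 ul e e0.
  by exists N => n /uN; rewrite distrC.
apply: R_complete; apply: cauchy_exP => e e0.
have [N uN] := uC e e0; exists (u N); exists N => // n Nn.
exact: uN.
Qed.

Lemma normc_Re_le (a : C) : `|complex.Re a| <= normc a.
Proof. by rewrite -lecR; exact: normc_ge_Re. Qed.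

Lemma normc_Im_le (a : C) : `|complex.Im a| <= normc a.
Proof.
by case: a => x y /=; rewrite -sqrtr_sqr ler_wsqrtr // lerDr sqr_ge0.
Qed.

Lemma normc_le_ReIm (a : C) : normc a <= `|complex.Re a| + `|complex.Im a|.
Proof.
case: a => x y /=; rewrite -[leRHS]ger0_norm ?addr_ge0 // -sqrtr_sqr.
rewrite ler_wsqrtr // sqrrD !real_normK ?num_real //.
by rewrite addrAC lerDl mulrn_wge0 ?mulr_ge0.
Qed.

Lemma complex_cauchy_cvg (z : nat -> C) :
  (forall e : R, 0 < e -> exists N : nat, forall m n : nat,
     (N <= m)%N -> (N <= n)%N -> normc (z m - z n) < e) ->
  exists l : C, forall e : R, 0 < e -> exists N : nat, forall n : nat,
     (N <= n)%N -> normc (z n - l) < e.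
Proof.
move=> zC.
have ReB (a b : C) : complex.Re (a - b) = complex.Re a - complex.Re b.
  by case: a b => [? ?] [? ?].
have ImB (a b : C) : complex.Im (a - b) = complex.Im a - complex.Im b.
  by case: a b => [? ?] [? ?].
have [e e0|x zx] := @real_cauchy_cvg (fun n => complex.Re (z n)).
  have [N zN] := zC e e0; exists N => m n Nm Nn.
  apply: le_lt_trans (zN m n Nm Nn); have := normc_Re_le (z m - z n).
  by rewrite ReB.
have [e e0|y zy] := @real_cauchy_cvg (fun n => complex.Im (z n)).
  have [N zN] := zC e e0; exists N => m n Nm Nn.
  apply: le_lt_trans (zN m n Nm Nn); have := normc_Im_le (z m - z n).
  by rewrite ImB.
exists (x +i* y) => e e0; have e20 : 0 < e / 2 by rewrite divr_gt0.
have [[N zN] [M zM]] := (zx _ e20, zy _ e20).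
exists (maxn N M) => n; rewrite geq_max => /andP[Nn Mn].
apply: le_lt_trans (normc_le_ReIm _) _; rewrite ReB ImB [ltRHS]splitr.
exact: ltrD (zN n Nn) (zM n Mn).
Qed.

Lemma eventually_forall (T : finType) (P : T -> nat -> Prop) :
  (forall i, exists N : nat, forall n : nat, (N <= n)%N -> P i n) ->
  exists N : nat, forall n : nat, (N <= n)%N -> forall i, P i n.
Proof.
move=> /fin_all_exists [N PN]; exists (\max_i N i) => n Nn i; apply: PN.
exact: leq_trans (leq_bigmax i) Nn.
Qed.

(** The operator norm bounds every entry and is bounded by their sum, so Cauchy
    sequences and limits may be taken entry by entry. *)
Lemma opnorm_complete d (x_ : nat -> 'M[C]_d.+1) :
  (forall e : R, 0 < e -> exists N : nat, forall m n : nat,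
     (N <= m)%N -> (N <= n)%N -> opnorm (x_ m - x_ n) < e) ->
  exists x, forall e : R, 0 < e -> exists N : nat, forall n : nat,
     (N <= n)%N -> opnorm (x_ n - x) < e.
Proof.
move=> xC.
have /fin_all_exists [l xl] : forall ij : 'I_d.+1 * 'I_d.+1, exists l : C,
    forall e : R, 0 < e -> exists N : nat, forall n : nat,
    (N <= n)%N -> normc (x_ n ij.1 ij.2 - l) < e.
  case=> i j; apply: complex_cauchy_cvg => e e0; have [N xN] := xC e e0.
  exists N => m n Nm Nn; apply: le_lt_trans (xN m n Nm Nn).
  by have := normc_entry_le_opnorm (x_ m - x_ n) i j; rewrite !mxE.
exists (\matrix_(i, j) l (i, j)) => e e0.
pose K : R := (d.+1 * d.+1)%:R.
have K0 : 0 < K by rewrite ltr0n.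
have [|N xN] := @eventually_forall _
    (fun ij n => normc (x_ n ij.1 ij.2 - l ij) < e / K).
  by move=> ij; apply: xl; rewrite divr_gt0.
exists N => n Nn; apply: le_lt_trans (opnorm_le_sum _) _.
rewrite pair_big /=.
have -> : e = \sum_(ij : 'I_d.+1 * 'I_d.+1) e / K.
  by rewrite sumr_const card_prod !card_ord -[RHS]mulr_natr divfK ?gt_eqF.
apply: ltr_sum => [|ij _].
  by apply/hasP; exists (ord0, ord0); rewrite ?mem_index_enum.
by rewrite !mxE -surjective_pairing; exact: xN.
Qed.

End Completeness.

Section MatrixCstar.
Local Open Scope sesquilinear_scope.
Context (R : realType) (d : nat).
Local Notation M := 'M[R[i]]_d.+1.

Let mxstar (A : M) : M := A^t*.

Let mxstarD : {morph mxstar : x y / x + y}.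
Proof. by move=> x y; rewrite /mxstar linearD map_mxD. Qed.

Let mxstarZ (a : R[i]) (x : M) : mxstar (a *: x) = a^* *: mxstar x.
Proof. by rewrite /mxstar linearZ /= map_mxZ. Qed.

Let mxstarM (x y : M) : mxstar (x * y) = mxstar y * mxstar x.
Proof. exact: adjmxM. Qed.

Let mx_normZ (a : R[i]) (x : M) :
  (opnorm (a *: x))%:C%C = `|a| * (opnorm x)%:C%C.
Proof. by rewrite opnormZ rmorphM. Qed.

HB.instance Definition _ := isCstarAlgebra.Build R M
  mxstarD mxstarZ mxstarM (@trmxCK _ _ _) (@opnorm_eq0 R d.+1)
  (@opnormD R d.+1) mx_normZ (@opnormM R d.+1) (@opnorm_star R d.+1)
  (@opnorm_complete R d).

End MatrixCstar.

(** * Extending partial injections to unitary matrices *)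

(** If [p] does it for [s], then exchanging [p (src k)] and [tgt k] afterwards
    also sends [src k] to [tgt k]; by injectivity neither exchanged point is the
    image of an older source. *)
Lemma perm_extending (I T : finType) (s : seq I) (src tgt : I -> T) :
  {in s &, injective src} -> {in s &, injective tgt} ->
  exists p : {perm T}, {in s, forall k, p (src k) = tgt k}.
Proof.
elim: s => [|k s IHs] srcI tgtI; first by exists 1%g.
have sub x : x \in s -> x \in k :: s by rewrite inE orbC => ->.
have [||p ps] := IHs.
- by move=> x y /sub xs /sub ys; exact: srcI.
- by move=> x y /sub xs /sub ys; exact: tgtI.
have [ks|ks] := boolP (k \in s).
  by exists p => x; rewrite inE => /orP[/eqP ->|]; exact: ps.
exists (p * tperm (p (src k)) (tgt k))%g => x.
rewrite inE permM => /orP[/eqP ->|xs]; first by rewrite tpermL.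
have xk : x != k by apply: contraNneq ks => <-.
rewrite -(ps x xs) tpermD //.
  rewrite (inj_eq perm_inj); apply: contraNneq xk => /srcI -> //.
    exact: mem_head.
  exact: sub.
rewrite (ps x xs); apply: contraNneq xk => /tgtI -> //; last exact: sub.
exact: mem_head.
Qed.

Section Monomial.
Local Open Scope sesquilinear_scope.

Lemma monomial_unitary_extending (C : numClosedFieldType) (d : nat)
    (I : finType) (s : seq I) (src tgt : I -> 'I_d) (c : I -> C) :
  {in s &, injective src} -> {in s &, injective tgt} ->
  (forall k, `|c k| = 1) ->
  exists U : 'M[C]_d, U \is unitarymx /\
    {in s, forall k,
      delta_mx 0 (src k) *m U = c k *: delta_mx 0 (tgt k) :> 'rV_d}.
Proof.
move=> srcI tgtI c1; have [p ps] := perm_extending srcI tgtI.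
pose phase x :=
  if [pick k | (k \in s) && (src k == x)] is Some k then c k else 1.
have phase1 x : phase x * (phase x)^* = 1.
  rewrite -normCK /phase; case: pickP => [k _|_]; last by rewrite normr1 expr1n.
  by rewrite c1 expr1n.
exists (\matrix_x (phase x *: delta_mx 0 (p x))); split.
  apply/row_unitarymxP => i j; rewrite !rowK dotmxE linearZ /= map_mxZ.
  rewrite -scalemxAl -scalemxAr scalerA trmx_delta map_delta_mx.
  rewrite mul_delta_mx_cond (inj_eq perm_inj).
  have [->|_] := eqVneq i j; last by rewrite mulr0n scaler0 mxE.
  by rewrite !mxE phase1 !mulr1.
move=> k ks; rewrite -rowE rowK ps // /phase.
case: pickP => [k' /andP[k's /eqP /srcI -> //]|/(_ k)].
by rewrite ks eqxx.
Qed.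

End Monomial.

(** * Eigenvalues of words in unitary matrices *)

Section Words.
Local Open Scope sesquilinear_scope.
Context {C : numClosedFieldType} {n d : nat}.
Local Notation letter := ('I_n * bool)%type.
Implicit Types (U : 'I_n -> 'M[C]_d) (s t : seq letter).

Definition lettermx U (a : letter) : 'M[C]_d :=
  if a.2 then U a.1 else (U a.1)^t*.

Definition wordmx U s : 'M[C]_d := foldr (fun a M => lettermx U a *m M) 1%:M s.

Lemma wordmx_cat U s t : wordmx U (s ++ t) = wordmx U s *m wordmx U t.
Proof. by elim: s => [|a s IHs] /=; rewrite ?mul1mx // IHs mulmxA. Qed.

Lemma lettermx_inv U a : lettermx U (letter_inv a) = (lettermx U a)^t*.
Proof. by case: a => i [] //=; rewrite /lettermx /= trmxCK. Qed.

Section Unitary.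
Variable U : 'I_n -> 'M[C]_d.
Hypothesis U_unitary : forall i, U i \is unitarymx.

Lemma lettermx_unitary a : lettermx U a \is unitarymx.
Proof. by case: a => i []; rewrite /lettermx /= ?trmxC_unitary. Qed.

Lemma wordmx_unitary s : wordmx U s \is unitarymx.
Proof.
elim: s => [|a s IHs] /=; last by rewrite mul_unitarymx ?lettermx_unitary.
by apply/unitarymxP; rewrite trmx1 map_mx1 mulmx1.
Qed.

Lemma wordmx_push a s : wordmx U (push a s) = lettermx U a *m wordmx U s.
Proof.
case: s => [//|b s] /=; case: eqP => [->|//].
by rewrite lettermx_inv mulmxA (unitarymxP _) ?lettermx_unitary ?mul1mx.
Qed.

Lemma wordmx_mul s t :
  wordmx U (foldr (@push n) t s) = wordmx U s *m wordmx U t.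
Proof.
by elim: s => [|a s IHs] /=; rewrite ?mul1mx // wordmx_push IHs mulmxA.
Qed.

End Unitary.

Definition cyclically_reduced s : bool :=
  cycle (fun a b => b != letter_inv a) s.

(** The vertices are the first [m] basis vectors, where [m] is the length of
    the word, and its [k]-th letter is to carry vertex [k] to vertex [k + 1]
    modulo [m], up to a phase that is [lambda] for [k = 0] and [1] otherwise.
    Thus the generator of that letter gets the edge from [k] to [k + 1], or the
    reverse edge if the letter is an inverse. *)
Lemma cyclic_word_eigenvalue s (lambda : C) :
  `|lambda| = 1 -> s != [::] -> cyclically_reduced s -> (size s <= d)%N ->
  exists2 U : 'I_n -> 'M[C]_d,
    forall i, U i \is unitarymx & eigenvalue (wordmx U s) lambda.
Proof.
case: s => [//|x p] lambda1 _ cyc le_d.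
set s := x :: p in cyc le_d *.
pose m := size s; pose a (k : 'I_m) := nth x s k.
have aS k : a (ordS k) != letter_inv (a k).
  have /(pathP x) /(_ k) := cyc; rewrite size_rcons => /(_ (ltn_ord k)).
  rewrite -[_ :: rcons _ _]/(rcons s x) !nth_rcons !if_same (ltn_ord k).
  congr (_ != _); rewrite /a /=.
  have := ltn_ord k; rewrite ltnS leq_eqVlt => /orP[/eqP kp|kp].
    by rewrite kp modnn ltnn.
  by rewrite modn_small ?ltnS // kp.
pose vtx k : 'I_d := widen_ord le_d k.
have vtxI : injective vtx by move=> k l /(congr1 val) /= /val_inj.
pose c (k : 'I_m) := if k == ord0 then lambda else 1.
have c1 k : `|c k| = 1 by rewrite /c; case: ifP; rewrite ?normr1.
pose src k := vtx (if (a k).2 then k else ordS k).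
pose tgt k := vtx (if (a k).2 then ordS k else k).
pose phase k := if (a k).2 then c k else (c k)^*.
(* Two edges of one generator and opposite directions never share a source or
   a target: their letters would be adjacent and mutually inverse. *)
have backtrack k l : (a k).1 = (a l).1 -> (a k).2 = ~~ (a l).2 -> k != ordS l.
  move=> e1 e2; apply: contraNneq (aS l) => <-.
  by rewrite /letter_inv -e1 -e2 -surjective_pairing.
have /fin_all_exists [U /all_and2 [UU UE]] : forall i : 'I_n,
    exists U : 'M[C]_d, U \is unitarymx /\
      {in [seq k <- enum 'I_m | (a k).1 == i], forall k,
        delta_mx 0 (src k) *m U = phase k *: delta_mx 0 (tgt k) :> 'rV_d}.
  move=> i; apply: monomial_unitary_extending; last first.
  - by move=> k; rewrite /phase; case: ifP; rewrite ?norm_conjC c1.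
  - move=> k l; rewrite !mem_filter => /andP[/eqP ki _] /andP[/eqP li _] /vtxI.
    case kb: (a k).2; case lb: (a l).2 => //; first exact: ordS_inj.
      by move=> /esym/eqP; rewrite (negPf (backtrack _ _ _ _)) ?ki ?li ?kb ?lb.
    by move=> /eqP; rewrite (negPf (backtrack _ _ _ _)) ?ki ?li ?kb ?lb.
  - move=> k l; rewrite !mem_filter => /andP[/eqP ki _] /andP[/eqP li _] /vtxI.
    case kb: (a k).2; case lb: (a l).2 => //; last exact: ordS_inj.
      by move=> /eqP; rewrite (negPf (backtrack _ _ _ _)) ?ki ?li ?kb ?lb.
    by move=> /esym/eqP; rewrite (negPf (backtrack _ _ _ _)) ?ki ?li ?kb ?lb.
have step k : delta_mx 0 (vtx k) *m lettermx U (a k) =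
    c k *: delta_mx 0 (vtx (ordS k)) :> 'rV_d.
  have := UE (a k).1 k; rewrite mem_filter eqxx mem_enum => /(_ isT).
  rewrite /src /tgt /phase /lettermx; case: (a k).2 => // E.
  rewrite -[delta_mx 0 (vtx (ordS k))](mulmxtVK _ (UU (a k).1)) E.
  by rewrite -scalemxAl scalerA -normCK c1 expr1n scale1r.
have walk1 j : (j < m)%N ->
    delta_mx 0 (vtx (inZp j)) *m wordmx U (drop j s) = c (inZp j) *:
      (delta_mx 0 (vtx (inZp j.+1)) *m wordmx U (drop j.+1 s)) :> 'rV_d.
  move=> jm; have jE : nat_of_ord (inZp j : 'I_m) = j by rewrite /= modn_small.
  have := step (inZp j); rewrite /a jE (drop_nth x jm) /= mulmxA => ->.
  rewrite -scalemxAl; congr (_ *: (delta_mx 0 (vtx _) *m _)).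
  by apply: val_inj; rewrite /= (modn_small jm).
(* The phase sits on the first edge, so every later start leads back to vertex
   0 with factor 1. *)
have walk r : (r < m)%N -> delta_mx 0 (vtx (inZp (m - r))) *m
    wordmx U (drop (m - r) s) = delta_mx 0 (vtx (inZp 0)) :> 'rV_d.
  elim: r => [|r IHr] rm.
    rewrite subn0 drop_size mulmx1; congr (delta_mx 0 (vtx _)).
    by apply: val_inj; rewrite /= modnn.
  have jm : (m - r.+1 < m)%N by rewrite ltn_subrL.
  rewrite (walk1 _ jm) -subSn ?(ltnW rm) // subSS IHr ?(ltnW rm) //.
  rewrite /c ifN ?scale1r // -val_eqE /= modn_small //.
  by rewrite -lt0n subn_gt0.
exists U => //; apply/eigenvalueP; exists (delta_mx 0 (vtx (inZp 0))).
  have := walk1 0 (ltn0Sn _); rewrite drop0 => ->.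
  by have := walk (size p) (ltnSn _); rewrite subSnn => ->.
apply/eqP => /rowP /(_ (vtx (inZp 0))) /eqP.
by rewrite !mxE !eqxx oner_eq0.
Qed.

Lemma eigenvalue_conj_unitary (V W : 'M[C]_d) (lambda : C) :
  V \is unitarymx -> eigenvalue W lambda -> eigenvalue (V *m W *m V^t*) lambda.
Proof.
move=> Vu /eigenvalueP [v vW v0]; apply/eigenvalueP; exists (v *m V^t*).
  by rewrite !mulmxA mulmxKtV // vW -scalemxAl.
by apply: contra_neq v0 => v0; rewrite -(mulmxKtV v Vu erefl) v0 mul0mx.
Qed.

Lemma reduced_word_eigenvalue s (lambda : C) :
  `|lambda| = 1 -> s != [::] -> reduced s -> (size s <= d)%N ->
  exists2 U : 'I_n -> 'M[C]_d,
    forall i, U i \is unitarymx & eigenvalue (wordmx U s) lambda.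
Proof.
move=> lambda1; have [r] := ubnP (size s); elim: r s => // r IHr s.
have [cyc _ s0 _ sd|] := boolP (cyclically_reduced s).
  exact: cyclic_word_eigenvalue.
case: s => [//|x p]; rewrite /cyclically_reduced /= rcons_path.
move=> ncyc sr _ red sd; move: ncyc; rewrite [path _ _ _]red /= negbK.
case: (lastP p) red sr sd => [|t y] red sr sd.
  (* A letter is never its own inverse. *)
  by move=> /eqP /(congr1 snd) /=; case: x.2.
rewrite last_rcons => /eqP xE.
have [t0|t0] := eqVneq t [::].
  by move: red; rewrite t0 xE /= letter_invK eqxx.
have [|||U UU Ueig] := IHr t _ t0.
- by move: sr; rewrite /= size_rcons ltnS; exact: ltnW.
- by move: red => /reduced_behead; rewrite /reduced -cats1 => /cat_sorted2[].
- by apply: leq_trans sd; rewrite /= size_rcons -addn2 leq_addr.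
exists U => //; rewrite -cats1 -cat1s !wordmx_cat /= !mulmx1 mulmxA.
have := eigenvalue_conj_unitary (lettermx_unitary UU x) Ueig.
by rewrite xE lettermx_inv trmxCK.
Qed.

End Words.

(** * Representations of the full group C*-algebra *)

Section Representation.
Local Open Scope sesquilinear_scope.
Context {R : realType}.

Lemma wordmx_unitary_rep n d (U : 'I_n -> 'M[R[i]]_d.+1) :
  (forall i, U i \is unitarymx) ->
  unitary_rep (fun g : free_group n => wordmx U (word g)).
Proof.
move=> UU; split=> [//|g h|g]; first exact: wordmx_mul.
have /unitarymxP gV := wordmx_unitary UU (word g).
by split; [exact: mulmx1C gV | exact: gV].
Qed.

Lemma full_group_cstar_mx_rep (G : groupType) (A : cstarAlgType R) (u : G -> A)
    d (v : G -> 'M[R[i]]_d.+1) :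
  is_full_group_cstar u -> unitary_rep v ->
  exists2 pi : A -> 'M[R[i]]_d.+1, mx_rep pi & forall g, pi (u g) = v g.
Proof.
move=> [_ univ] /univ [pi [[[piZ _ piM piS] piu] _]].
by exists pi => //; split.
Qed.

Lemma eigenvalue_in_spectrum d (x : 'M[R[i]]_d) (lambda : R[i]) :
  eigenvalue x lambda -> lambda \in spectrum x.
Proof.
move=> /eigenvalueP [v vx v0]; apply/mem_set; apply/negP => xU.
case/eqP: v0; rewrite -(mulmxK xU v) mulmxBr vx mul_mx_scalar subrr.
exact: mul0mx.
Qed.

End Representation.

Theorem theorem6p2 (R : realType) (n : nat)
    (A : cstarAlgType R) (u : free_group n -> A)
    (hA : is_full_group_cstar u)
    (w : free_group n) (hw1 : w <> 1%g) (hbal : balanced u w)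
    (l : nat) (hl : word_length w = l)
    (lambda : R[i]) (hlambda : `|lambda| = 1) :
  exists pi : A -> 'M[R[i]]_(2 * l),
    mx_rep pi /\ lambda \in spectrum (pi (u w)).
Proof.
have w0 : word w != [::].
  by apply/eqP => w0; apply: hw1; apply: val_inj.
have l0 : (0 < l)%N by rewrite -hl lt0n size_eq0.
have : (size (word w) <= 2 * l)%N by rewrite hl mul2n -addnn leq_addr.
have : (0 < 2 * l)%N by rewrite muln_gt0.
case: (2 * l)%N => // d _ wd.
have [U UU Ueig] := reduced_word_eigenvalue hlambda w0 (word_reduced w) wd.
have [pi pi_rep piu] := full_group_cstar_mx_rep hA (wordmx_unitary_rep UU).
by exists pi; split=> //; rewrite piu; exact: eigenvalue_in_spectrum.
Qed.
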